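(* Let $G_1$ and $G_2$ be two connected graphs, each with $n$ vertices and $m$ edges, having Laplacian spectra $0=\mu_n<\mu_{n-1}\leq\cdots\leq\mu_1$ and $0=\lambda_n<\lambda_{n-1}\leq\cdots\leq\lambda_1$, respectively. Let $p\geq n+4$ be a positive integer such that $$\frac{2m}{p+n}<\min(\mu_{n-1},\lambda_{n-1}).$$ Then $LE(\tilde{G_1})=LE(\tilde{G_2})$, where $\tilde{G_i}=(G_i\vee\overline{K_p})\times K_p$ for $i=1,2$.
   Context: All graphs are finite, undirected and simple. For a graph $G$ with $N$ vertices and $M$ edges, adjacency matrix $A(G)$ and diagonal degree matrix $D(G)$, the Laplacian matrix is $L(G)=D(G)-A(G)$; its eigenvalues with multiplicity, $\mu_1,\dots,\mu_N$, form the Laplacian spectrum of $G$. The Laplacian energy is $LE(G)=\sum_{i=1}^{N}\left|\mu_i-\frac{2M}{N}\right|$. $K_p$ is the complete graph on $p$ vertices, $\overline{K_p}$ the graph on $p$ vertices with no edges, and the join $G\vee H$ is obtained from the disjoint union of $G$ and $H$ by adding all edges between vertices of $G$ and vertices of $H$. $G\times H$ is the Cartesian product: vertex set $V(G)\times V(H)$, with $(u_1,v_1)$ adjacent to $(u_2,v_2)$ iff either $u_1=u_2$ and $v_1v_2\in E(H)$, or $v_1=v_2$ and $u_1u_2\in E(G)$. Writing $\mu_{n-1}$ presupposes $n\ge 2$. *)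

(* Defs.v *)
From mathcomp Require Import all_boot all_order all_algebra.
From mathcomp Require Import complex.

Set Implicit Arguments.
Unset Strict Implicit.
Unset Printing Implicit Defensive.

Import Order.TTheory GRing.Theory Num.Theory.
Local Open Scope ring_scope.

Record sgraph := SGraph {
  vertex :> finType;
  edge : rel vertex;
  edge_sym : symmetric edge;
  edge_irrefl : irreflexive edge }.

(* An edge is an unordered pair, so that each one is counted once. *)
Definition edges (G : sgraph) : {set {set G}} :=
  [set e | [exists x : G, exists y : G, edge x y && (e == [set x; y])]].

Definition nb_edges (G : sgraph) : nat := #|edges G|.

Definition degree (G : sgraph) (x : G) : nat := #|[set y | edge x y]|.

Definition connected_graph (G : sgraph) : Prop :=
  (0 < #|G|)%N /\ forall x y : G, connect (@edge G) x y.

Section Families.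
Variable p : nat.

Definition complete_rel : rel 'I_p := fun i j => i != j.

Lemma complete_sym : symmetric complete_rel.
Proof. by move=> i j; rewrite /complete_rel eq_sym. Qed.

Lemma complete_irrefl : irreflexive complete_rel.
Proof. by move=> i; rewrite /complete_rel eqxx. Qed.

Definition complete_graph : sgraph := SGraph complete_sym complete_irrefl.

Definition edgeless_rel : rel 'I_p := fun _ _ => false.

Lemma edgeless_sym : symmetric edgeless_rel. Proof. by []. Qed.

Lemma edgeless_irrefl : irreflexive edgeless_rel. Proof. by []. Qed.

Definition edgeless_graph : sgraph := SGraph edgeless_sym edgeless_irrefl.

End Families.

Section Operations.
Variables G H : sgraph.

Definition join_rel : rel (G + H)%type := fun x y =>
  match x, y with
  | inl u, inl v => edge u v
  | inr u, inr v => edge u v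
  | _, _ => true
  end.

Lemma join_sym : symmetric join_rel.
Proof. by case=> u [] v //=; apply: edge_sym. Qed.

Lemma join_irrefl : irreflexive join_rel.
Proof. by case=> u /=; apply: edge_irrefl. Qed.

Definition join_graph : sgraph := SGraph join_sym join_irrefl.

Definition cart_rel : rel (G * H)%type := fun x y =>
  (x.1 == y.1) && edge x.2 y.2 || (x.2 == y.2) && edge x.1 y.1.

Lemma cart_sym : symmetric cart_rel.
Proof.
by move=> x y; rewrite /cart_rel (eq_sym x.1) (eq_sym x.2) !(edge_sym y.1, edge_sym y.2)
  (edge_sym x.1) (edge_sym x.2).
Qed.

Lemma cart_irrefl : irreflexive cart_rel.
Proof. by move=> x; rewrite /cart_rel !edge_irrefl !andbF. Qed.

Definition cart_graph : sgraph := SGraph cart_sym cart_irrefl.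

End Operations.

Section RealSymmetric.
Variables (R : rcfType) (n : nat).

Lemma char_poly_similar (F : fieldType) (P D : 'M[F]_n) :
  P \in unitmx -> char_poly (invmx P *m D *m P) = char_poly D.
Proof.
move=> uP; rewrite /char_poly.
have -> : char_poly_mx (invmx P *m D *m P) =
    map_mx polyC (invmx P) *m char_poly_mx D *m map_mx polyC P.
  rewrite /char_poly_mx mulmxBr mulmxBl -!map_mxM /=; congr (_ - _).
  by rewrite mul_mx_scalar -scalemxAl -map_mxM mulVmx // map_mx1 scalemx1.
rewrite !det_mulmx mulrAC -det_mulmx -map_mxM mulVmx //.
by rewrite map_mx1 det1 mul1r.
Qed.

Lemma sym_char_poly_split (A : 'M[R]_n) : A^T = A ->
  exists s : seq R, sorted >=%R s &&
    (char_poly A == \prod_(x <- s) ('X - x%:P)).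
Proof.
move=> symA; pose B : 'M[R[i]]_n := map_mx (real_complex R) A.
have hermB : B \is hermsymmx.
  apply: realsym_hermsym.
    by apply/is_hermitianmxP; rewrite expr0 scale1r map_mx_id // map_trmx symA.
  by apply/mxOverP => i j; rewrite mxE; apply/complex_realP; exists (A i j).
have /mxOverP dR := hermitian_spectral_diag_real hermB.
have /orthomx_spectralP eB := hermitian_normalmx hermB.
pose t := [seq complex.Re (spectral_diag B 0 i) | i : 'I_n].
exists (sort >=%R t); rewrite sort_sorted; last exact: ge_total.
apply/eqP/(map_poly_inj (real_complex R)).
rewrite map_char_poly -/B eB char_poly_similar ?spectral_unit //.
rewrite char_poly_trig; last exact/diag_mx_is_trig.
rewrite (perm_big t) ?perm_sort //= big_map big_enum rmorph_prod /=.
apply: eq_bigr => i _; rewrite mxE eqxx mulr1n.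
by rewrite rmorphB /= map_polyX map_polyC /= RRe_real.
Qed.

(* The eigenvalues of a real symmetric matrix, i.e. the roots of its
   characteristic polynomial (eigenvalue_root_char), with multiplicity and in
   nonincreasing order; these two conditions determine the list. *)
Definition sym_spectrum (A : 'M[R]_n) (symA : A^T = A) : seq R :=
  xchoose (sym_char_poly_split symA).

Lemma sym_spectrumP (A : 'M[R]_n) (symA : A^T = A) :
  sorted >=%R (sym_spectrum symA) /\
  char_poly A = \prod_(x <- sym_spectrum symA) ('X - x%:P).
Proof. by have /andP[? /eqP] := xchooseP (sym_char_poly_split symA). Qed.

End RealSymmetric.

Section Laplacian.
Variables (R : rcfType) (G : sgraph).

Definition adjacency_mx : 'M[R]_#|G| :=
  \matrix_(i, j) (edge (enum_val i) (enum_val j))%:R.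

Definition degree_mx : 'M[R]_#|G| :=
  diag_mx (\row_i (degree (enum_val i))%:R).

Definition laplacian_mx : 'M[R]_#|G| := degree_mx - adjacency_mx.

Lemma laplacian_mx_sym : laplacian_mx^T = laplacian_mx.
Proof.
rewrite /laplacian_mx linearB /= tr_diag_mx; congr (_ - _).
by apply/matrixP => i j; rewrite !mxE edge_sym.
Qed.

Definition laplacian_spectrum : seq R := sym_spectrum laplacian_mx_sym.

(* The k-th largest Laplacian eigenvalue, counting from k = 1. *)
Definition laplacian_eig (k : nat) : R := nth 0 laplacian_spectrum k.-1.

Definition laplacian_energy : R :=
  \sum_(mu <- laplacian_spectrum) `|mu - (2 * nb_edges G)%:R / #|G|%:R|.

End Laplacian.

(* Main.v *)
(** Let [c] be the average degree of [(G \/ edgeless p) x K_p], where [G] has [n]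
    vertices and [m] edges. The product has the eigenvalues [a] and [a + p] ([p - 1]
    times), where [a] runs over the Laplacian spectrum of the join: [0], [n + p], [n]
    ([p - 1] times), and [mu + p] for each eigenvalue [mu] of [G] other than one copy
    of [0]. Since [mu <= n], the hypothesis [p >= n + 4] forces [mu + p <= c], while
    [mu > 2m / (p + n)] forces [mu + 2p >= c]. So every absolute value involving [mu]
    opens with a sign that does not depend on [G], and the energy depends on the [mu]
    only through their sum [2m]. *)
Require Import Defs.
From mathcomp Require Import all_boot all_order all_algebra.
From mathcomp Require Import complex zify ring lra.
Import Order.TTheory GRing.Theory Num.Theory.
Local Open Scope ring_scope.

Set Implicit Arguments.
Unset Strict Implicit.
Unset Printing Implicit Defensive.

(** * The Laplace operator of a relation, acting on functions on the vertices *)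

Section LaplaceOperator.
Variables (T : finType) (e : rel T).

Definition laplace (V : zmodType) (f : T -> V) (x : T) : V :=
  \sum_(y | e x y) (f x - f y).

(** The terms over [e] and over its negation together sum [f x - f y] over all [y]. When [e] is
    irreflexive, its negation contains the diagonal, whose terms vanish, so the left side is the
    Laplacian of the complement graph. *)
Lemma laplace_compl (V : zmodType) (f : T -> V) x :
  \sum_(y | ~~ e x y) (f x - f y) = f x *+ #|T| - \sum_y f y - laplace f x.
Proof.
by rewrite -sumr_const -sumrB [in RHS](bigID (e x)) /= addrAC subrr add0r.
Qed.

(** The Dirichlet form. Exchanging the roles of [x] and [y] gives a second expression [E'] for the
    same sum, and adding the two completes the square. *)
Lemma laplace_quad (C : numClosedFieldType) (f : T -> C) : symmetric e ->
  (\sum_x laplace f x * (f x)^*) *+ 2 =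
  \sum_x \sum_(y | e x y) `|f x - f y| ^+ 2.
Proof.
move=> e_sym; have E : \sum_x laplace f x * (f x)^* =
    \sum_x \sum_(y | e x y) (f x - f y) * (f x)^*.
  by apply: eq_bigr => x _; rewrite /laplace mulr_suml.
have E' : \sum_x laplace f x * (f x)^* =
    \sum_x \sum_(y | e x y) (f y - f x) * (f y)^*.
  rewrite E (exchange_big_dep xpredT) //=; apply: eq_bigr => x _.
  by apply: eq_bigl => y; rewrite e_sym.
rewrite mulr2n {1}E E' -big_split /=; apply: eq_bigr => x _.
rewrite -big_split /=; apply: eq_bigr => y _.
by rewrite normCK rmorphB /=; ring.
Qed.

Lemma laplace_sum (V : zmodType) (f : T -> V) : symmetric e ->
  \sum_x laplace f x = 0.
Proof.
move=> e_sym; under eq_bigr do rewrite /laplace sumrB.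
rewrite sumrB [X in _ - X](exchange_big_dep xpredT) //= -sumrB big1 // => x _.
by apply/eqP; rewrite subr_eq0; apply/eqP/eq_bigl => y; rewrite e_sym.
Qed.

End LaplaceOperator.

(** * Orthogonal eigenfunctions and the Laplacian spectrum *)

Section Eigenbasis.
Variable R : rcfType.
Local Notation C := R[i].

(* Pairwise orthogonal nonzero functions, as many as vertices: independence is
   automatic, and no normalization has to be carried through the constructions. *)
Definition eigenbasis (G : sgraph) (I : finType) (f : I -> G -> C)
    (d : I -> R) :=
  [/\ #|I| = #|G|, forall i, exists x, f i x != 0,
      forall i j, i != j -> \sum_x f i x * (f j x)^* = 0
    & forall i x, laplace (@edge G) (f i) x = (d i)%:C%C * f i x].

(** A function is read as a row vector, so that a family of functions becomes the rows of a matrix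
    multiplying the Laplacian from the left. *)
Lemma laplacian_mx_laplace (G : sgraph) (f : G -> C) (y : 'I_#|G|) :
  \sum_x f (enum_val x) * (laplacian_mx R G x y)%:C%C =
  laplace (@edge G) f (enum_val y).
Proof.
rewrite /laplace sumrB sumr_const.
rewrite (eq_bigr (fun x => (f (enum_val x) * (degree (enum_val y))%:R) *+ (x == y)
   - (if edge (enum_val x) (enum_val y) then f (enum_val x) else 0))); last first.
  move=> x _; rewrite !mxE; have [->|_] := eqVneq x y.
    by rewrite edge_irrefl !mulr1n subr0 rmorph_nat subr0.
  rewrite !mulr0n sub0r rmorphN rmorph_nat mulrN sub0r.
  by case: edge; rewrite ?mulr1 ?mulr0.
rewrite sumrB -big_mkcond (bigD1 y) //= eqxx big1 ?addr0; last first.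
  by move=> x /negPf->.
rewrite mulr1n mulr_natr; congr (_ *+ _ - _).
  by rewrite /degree cardsE.
rewrite [RHS](reindex _ (onW_bij _ (enum_val_bij G))) /=.
by apply: eq_bigl => x; rewrite edge_sym.
Qed.

(** Orthogonality makes [P] times its conjugate transpose diagonal with nonzero entries, so [P] is
    invertible and conjugates the Laplacian to the diagonal matrix of the [d i]. Equal
    characteristic polynomials then have the same roots with multiplicity. *)
Lemma eigenbasis_spectrum (G : sgraph) (I : finType) (f : I -> G -> C)
    (d : I -> R) :
  eigenbasis f d -> perm_eq (laplacian_spectrum R G) [seq d i | i : I].
Proof.
case=> cI f0 f_orth f_eig.
pose h (k : 'I_#|G|) : I := enum_val (cast_ord (esym cI) k).
have h_bij : bijective h.
  apply: bij_comp; first exact: enum_val_bij.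
  by exists (cast_ord cI); [exact: cast_ordKV | exact: cast_ordK].
pose P : 'M[C]_#|G| := \matrix_(k, x) f (h k) (enum_val x).
pose N k := \sum_x `|f (h k) x| ^+ 2.
have PP : P *m map_mx Num.conj P^T = diag_mx (\row_k N k).
  apply/matrixP => k l; rewrite !mxE.
  under eq_bigr do rewrite !mxE.
  have -> : \sum_(x < #|G|) f (h k) (enum_val x) * (f (h l) (enum_val x))^* =
      \sum_x f (h k) x * (f (h l) x)^*.
    by rewrite [RHS](reindex _ (onW_bij _ (enum_val_bij G))).
  have [<-|kl] := eqVneq; first by rewrite mulr1n; apply: eq_bigr => x _; rewrite normCK.
  by rewrite f_orth // (inj_eq (bij_inj h_bij)).
have uP : P \in unitmx.
  have: P *m map_mx Num.conj P^T \in unitmx.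
    rewrite PP unitmxE det_diag unitfE; apply/prodf_neq0 => k _.
    rewrite mxE; have [x fx0] := f0 (h k); rewrite psumr_neq0 => [|y _].
      by apply/hasP; exists x; rewrite ?mem_index_enum //= exprn_gt0 ?normr_gt0.
    by rewrite exprn_ge0.
  by rewrite unitmx_mul => /andP[].
pose L := map_mx (real_complex R) (laplacian_mx R G).
pose D : 'M[C]_#|G| := diag_mx (\row_k (d (h k))%:C%C).
have PL : P *m L = D *m P.
  apply/matrixP => k y; rewrite mul_diag_mx !mxE -f_eig -laplacian_mx_laplace.
  by apply: eq_bigr => x _; rewrite !mxE.
have LE : L = invmx P *m D *m P by rewrite -mulmxA -PL mulKmx.
have [_ spec] := sym_spectrumP (@laplacian_mx_sym R G).
apply: prod_XsubC_eq; rewrite /laplacian_spectrum -spec.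
(* The spectrum is defined over [R] while [P] is complex; the embedding of [R] into [R[i]] is
   injective on polynomials. *)
apply: (map_poly_inj (real_complex R)).
rewrite map_char_poly -/L LE char_poly_similar // char_poly_trig ?diag_mx_is_trig //.
rewrite big_map big_enum /= (reindex _ (onW_bij _ h_bij)) /= rmorph_prod /=.
by apply: eq_bigr => k _; rewrite !mxE eqxx mulr1n rmorphB /= map_polyX map_polyC.
Qed.

(** * Connected graphs and eigenbases containing the constant function 1 *)

Lemma laplace_cst (G : sgraph) (f : G -> C) x c :
  (forall y, f y = c) -> laplace (@edge G) f x = 0.
Proof. by move=> fc; rewrite /laplace big1 // => y _; rewrite !fc subrr. Qed.

(** The Dirichlet form of [f] vanishes, so [f] agrees at the ends of every edge, hence along
    paths. *)
Lemma laplace_eq0_const (G : sgraph) (f : G -> C) :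
  connected_graph G -> (forall x, laplace (@edge G) f x = 0) ->
  forall x y, f x = f y.
Proof.
move=> [_ G_conn] lap0 x y.
have f_edge z t : edge z t -> f z = f t.
  move=> zt; have := laplace_quad f (@edge_sym G).
  rewrite big1 ?mul0rn => [/esym/eqP|u _]; last by rewrite lap0 mul0r.
  rewrite psumr_eq0 => [|u _]; last by apply: sumr_ge0 => v _; rewrite exprn_ge0.
  move=> /allP/(_ z (mem_index_enum _)) /=.
  rewrite psumr_eq0 => [|v _]; last by rewrite exprn_ge0.
  move=> /allP/(_ t (mem_index_enum _)); rewrite zt /= expf_eq0 /= normr_eq0.
  by rewrite subr_eq0 => /eqP.
have cl : closed (@edge G) [pred z | f x == f z].
  by move=> z t zt; rewrite !inE (f_edge z t zt).
by have := closed_connect cl (G_conn x y); rewrite !inE eqxx => /esym/eqP.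
Qed.

(* The other eigenfunctions then have zero sum, so they extend by zero to
   eigenfunctions of a join. *)
Definition unit_eigenbasis (G : sgraph) (I : finType) (i0 : I)
    (f : I -> G -> C) (d : I -> R) :=
  eigenbasis f d /\ forall x, f i0 x = 1.

(** The spectral theorem gives an orthonormal eigenbasis. One of its functions has eigenvalue 0, is
    constant by connectedness, and is replaced by 1. *)
Lemma connected_eigenbasis (G : sgraph) : connected_graph G ->
  exists (I : finType) (i0 : I) (f : I -> G -> C) d, unit_eigenbasis i0 f d.
Proof.
move=> G_conn; have [/card_gt0P[x0 _] _] := G_conn.
pose L := map_mx (real_complex R) (laplacian_mx R G).
have L_herm : L \is hermsymmx.
  apply: realsym_hermsym.
    apply/is_hermitianmxP; rewrite expr0 scale1r map_mx_id //.
    by rewrite map_trmx laplacian_mx_sym.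
  by apply/mxOverP => i j; rewrite mxE; apply/complex_realP; exists (laplacian_mx R G i j).
have /mxOverP D_real := hermitian_spectral_diag_real L_herm.
have /orthomx_spectralP LE := hermitian_normalmx L_herm.
set P := spectralmx L in LE; set D := spectral_diag L in D_real LE.
have uP : P \in unitmx := spectral_unit L.
have PL : P *m L = diag_mx D *m P.
  by rewrite [in LHS]LE mulmxA mulKVmx.
pose f k (x : G) := P k (enum_rank x).
pose d k := complex.Re (D 0 k).
have dE k : (d k)%:C%C = D 0 k by rewrite /d RRe_real.
have f_eig k x : laplace (@edge G) (f k) x = (d k)%:C%C * f k x.
  rewrite -{1}[x]enum_rankK -laplacian_mx_laplace dE.
  move/matrixP/(_ k (enum_rank x)): PL; rewrite mul_diag_mx !mxE => <-.
  by apply: eq_bigr => y _; rewrite !mxE /f enum_valK.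
have f_orth k l : \sum_x f k x * (f l x)^* = (k == l)%:R.
  have /unitarymxP/matrixP/(_ k l) := spectral_unitarymx L.
  rewrite !mxE => <-; rewrite (reindex _ (onW_bij _ (enum_val_bij G))) /=.
  by apply: eq_bigr => x _; rewrite !mxE /f enum_valK.
have f_neq0 k : exists x, f k x != 0.
  have [x|f0] := pickP (fun x => f k x != 0); first by exists x.
  have /eqP := f_orth k k; rewrite eqxx big1 => [|x _].
    by rewrite eq_sym oner_eq0.
  by have /negbFE := f0 x => /eqP->; rewrite mul0r.
(* A function with nonzero eigenvalue has zero sum, since its Laplacian does. If this held for all
   rows of [P], then [P] would kill the all-ones vector, although it is invertible. *)
have [i0 di0] : exists k, d k = 0.
  have [k /eqP|d_neq0] := pickP (fun k => d k == 0); first by exists k.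
  have: P *m const_mx 1 == 0 :> 'cV_#|G|.
    apply/eqP/matrixP => k j; rewrite !mxE.
    transitivity (\sum_x f k x).
      rewrite [RHS](reindex _ (onW_bij _ (enum_val_bij G))) /=.
      by apply: eq_bigr => x _; rewrite mxE mulr1 /f enum_valK.
    apply: (@mulfI _ (d k)%:C%C); first by rewrite fmorph_eq0 d_neq0.
    rewrite mulr0 mulr_sumr; under eq_bigr do rewrite -f_eig.
    by rewrite laplace_sum //; exact: edge_sym.
  rewrite -(inj_eq (can_inj (mulKVmx uP))) mulmx0 mulKmx //.
  by move=> /eqP/matrixP/(_ (enum_rank x0) 0)/eqP; rewrite !mxE oner_eq0.
have f_cst x y : f i0 x = f i0 y.
  by apply: laplace_eq0_const => // z; rewrite f_eig di0 mul0r.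
have fi0_neq0 : f i0 x0 != 0 by have [x] := f_neq0 i0; rewrite (f_cst x x0).
have sum_f k : k != i0 -> \sum_x f k x = 0.
  move=> ki0; apply: (@mulIf _ (f i0 x0)^*); first by rewrite conjC_eq0.
  rewrite mul0r mulr_suml.
  transitivity (\sum_x f k x * (f i0 x)^*); last by rewrite f_orth (negPf ki0).
  by apply: eq_bigr => x _; rewrite (f_cst x x0).
exists 'I_#|G|, i0, (fun k x => if k == i0 then 1 else f k x), d.
split; last by rewrite eqxx.
split=> [|k|k l kl|k x].
- by rewrite card_ord.
- by case: eqP => _; [exists x0; rewrite oner_eq0 | exact: f_neq0].
- have [ki|ki] := eqVneq k i0; have [li|li] := eqVneq l i0.
  + by rewrite ki li eqxx in kl.
  + transitivity ((\sum_x f l x)^*); last by rewrite sum_f // rmorph0.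
    by rewrite rmorph_sum; apply: eq_bigr => x _; rewrite mul1r.
  + by rewrite -[RHS](sum_f k ki); apply: eq_bigr => x _; rewrite rmorph1 mulr1.
  + by rewrite f_orth (negPf kl).
- have [->|_] := eqVneq k i0; last exact: f_eig.
  by rewrite di0 mul0r (@laplace_cst _ _ _ 1).
Qed.

Section UnitEigenbasis.
Variables (G : sgraph) (I : finType) (i0 : I) (f : I -> G -> C) (d : I -> R).
Hypothesis fd : unit_eigenbasis i0 f d.

Lemma unit_eigenbasis_gt0 : (0 < #|G|)%N.
Proof. by have [[<- _ _ _] _] := fd; apply/card_gt0P; exists i0. Qed.

Lemma unit_eigenbasis_sum i : i != i0 -> \sum_x f i x = 0.
Proof.
move=> ii0; have [[_ _ orth _] fi0] := fd.
by rewrite -[RHS](orth i i0 ii0); apply: eq_bigr => x _; rewrite fi0 rmorph1 mulr1.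
Qed.

Lemma unit_eigenbasis_eig0 : d i0 = 0.
Proof.
have [[_ _ _ eig] fi0] := fd; have /card_gt0P[x _] := unit_eigenbasis_gt0.
have := eig i0 x; rewrite fi0 mulr1 (@laplace_cst _ _ _ 1) // => /esym/eqP.
by rewrite fmorph_eq0 => /eqP.
Qed.

(** On a zero-sum eigenfunction the Laplacian of the complement acts as [#|G| - d i], and its
    Dirichlet form is nonnegative. *)
Lemma unit_eigenbasis_eig_le i : d i <= #|G|%:R.
Proof.
have [->|ii0] := eqVneq i i0; first by rewrite unit_eigenbasis_eig0 ler0n.
have [[_ f_neq0 _ eig] _] := fd.
pose e' x y := ~~ @edge G x y.
have e'_sym : symmetric e' by move=> x y; rewrite /e' edge_sym.
have lapE x : laplace e' (f i) x = (#|G|%:R - d i)%:C%C * f i x.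
  rewrite [LHS]laplace_compl unit_eigenbasis_sum // subr0 eig.
  by rewrite rmorphB rmorph_nat mulrBl mulr_natl.
have S_gt0 : 0 < \sum_x f i x * (f i x)^*.
  have [x fx] := f_neq0 i.
  rewrite (bigD1 x) //= ltr_wpDr ?sumr_ge0 //; first by move=> y _; rewrite mul_conjC_ge0.
  by rewrite mul_conjC_gt0.
have: 0 <= (\sum_x laplace e' (f i) x * (f i x)^*) *+ 2.
  rewrite laplace_quad //; apply: sumr_ge0 => x _; apply: sumr_ge0 => y _.
  by rewrite exprn_ge0.
under eq_bigr do rewrite lapE -mulrA.
by rewrite pmulrn_lge0 // -mulr_sumr pmulr_lge0 // ler0c subr_ge0.
Qed.

End UnitEigenbasis.

(** * Eigenbases of Cartesian products and joins *)

Lemma cart_eigenbasis (G H : sgraph) (I J : finType) (f : I -> G -> C)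
    (g : J -> H -> C) (d : I -> R) (e : J -> R) :
  eigenbasis f d -> eigenbasis g e ->
  @eigenbasis (cart_graph G H) (I * J)%type
    (fun k x => f k.1 x.1 * g k.2 x.2) (fun k => d k.1 + e k.2).
Proof.
move=> [cI f0 f_orth f_eig] [cJ g0 g_orth g_eig]; split=> /=.
- by rewrite !card_prod cI cJ.
- move=> [i j] /=; have [x fx] := f0 i; have [y gy] := g0 j.
  by exists (x, y); rewrite mulf_neq0.
- move=> [i j] [i' j'] neq /=.
  rewrite -(pair_bigA _ (fun x y => f i x * g j y * (f i' x * g j' y)^*)) /=.
  transitivity ((\sum_x f i x * (f i' x)^*) * \sum_y g j y * (g j' y)^*).
    rewrite mulr_suml; apply: eq_bigr => x _; rewrite mulr_sumr.
    by apply: eq_bigr => y _; rewrite rmorphM /=; ring.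
  move: neq; rewrite xpair_eqE negb_and => /orP[ii|jj].
    by rewrite f_orth // mul0r.
  by rewrite g_orth // mulr0.
- move=> [i j] [x y] /=; set F := fun z : G * H => f i z.1 * g j z.2.
  rewrite rmorphD mulrDl /=.
  (* Without loops the two alternatives of [cart_rel] exclude each other, so the sum over neighbours
     splits in two, one for each factor. *)
  transitivity (\sum_(z : G * H | (z.1 == x) && edge y z.2) (F (x, y) - F z) +
                \sum_(z : G * H | (edge x z.1) && (z.2 == y)) (F (x, y) - F z)).
    rewrite /laplace big_mkcond [X in _ = X + _]big_mkcond.
    rewrite [X in _ = _ + X]big_mkcond -big_split /=; apply: eq_bigr => -[x' y'] _.
    rewrite /cart_rel /= (eq_sym x') (eq_sym y').
    have [<-|_] := eqVneq x x'; rewrite ?edge_irrefl ?andbF ?orbF ?addr0 //=.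
    by rewrite add0r andbC.
  rewrite -(pair_big_dep (fun x' => x' == x) (fun x' y' => edge y y')
    (fun x' y' => F (x, y) - F (x', y'))) /=.
  rewrite -(pair_big_dep (fun x' => edge x x') (fun x' y' => y' == y)
    (fun x' y' => F (x, y) - F (x', y'))) /=.
  rewrite big_pred1_eq; under [X in _ + X]eq_bigr do rewrite big_pred1_eq.
  rewrite addrC /F /=; congr (_ + _).
    by rewrite mulrA -f_eig mulr_suml; apply: eq_bigr => z _; rewrite mulrBl.
  by rewrite mulrCA -g_eig mulr_sumr; apply: eq_bigr => z _; rewrite mulrBr.
Qed.

Lemma laplace_joinl (G H : sgraph) (F : join_graph G H -> C) (x : G) :
  laplace (@edge (join_graph G H)) F (inl x) =
  laplace (@edge G) (fun x => F (inl x)) x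
  + (F (inl x) *+ #|H| - \sum_(y : H) F (inr y)).
Proof. by rewrite /laplace big_sumType /= -sumr_const -sumrB. Qed.

Lemma laplace_joinr (G H : sgraph) (F : join_graph G H -> C) (y : H) :
  laplace (@edge (join_graph G H)) F (inr y) =
  (F (inr y) *+ #|G| - \sum_(x : G) F (inl x))
  + laplace (@edge H) (fun y => F (inr y)) y.
Proof. by rewrite /laplace big_sumType /= -sumr_const -sumrB. Qed.

Lemma sumr_cst (T : finType) (c : C) : \sum_(x : T) c = c * #|T|%:R.
Proof. by rewrite sumr_const mulr_natr. Qed.

(** Zero-sum eigenfunctions of either side extend by zero, and the added edges raise their
    eigenvalue by the size of the other side. What remains is the plane of functions constant on
    each side. *)
Lemma join_eigenbasis (G H : sgraph) (I J : finType) (i0 : I) (j0 : J)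
    (f : I -> G -> C) (g : J -> H -> C) (d : I -> R) (e : J -> R) :
  unit_eigenbasis i0 f d -> unit_eigenbasis j0 g e ->
  exists F : I + J -> join_graph G H -> C,
  @unit_eigenbasis (join_graph G H) (I + J)%type (inl i0) F
    (fun k => match k with
     | inl i => if i == i0 then 0 else d i + #|H|%:R
     | inr j => if j == j0 then (#|G| + #|H|)%:R else e j + #|G|%:R
     end).
Proof.
move=> fd ge; have [[cI f0 f_orth f_eig] fi0] := fd.
have [[cJ g0 g_orth g_eig] gj0] := ge.
have /card_gt0P[x0 _] := unit_eigenbasis_gt0 fd.
have f_sum := unit_eigenbasis_sum fd; have g_sum := unit_eigenbasis_sum ge.
(* That plane is spanned by the constant 1, at [inl i0], and by the function orthogonal to it with
   values [#|H|] on [G] and [- #|G|] on [H], at [inr j0]. *)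
pose F (k : I + J) (z : join_graph G H) : C := match k, z with
  | inl i, inl x => f i x
  | inl i, inr y => (i == i0)%:R
  | inr j, inl x => (if j == j0 then #|H| else 0)%:R
  | inr j, inr y => if j == j0 then - #|G|%:R else g j y
  end.
have FL i j : \sum_x F (inl i) x * (F (inr j) x)^* = 0.
  rewrite big_sumType /= -mulr_suml -mulr_sumr.
  have [->|ii0] := eqVneq i i0; last first.
    by rewrite f_sum // !mul0r addr0.
  have [jj0|jj0] := eqVneq j j0; last first.
    by rewrite rmorph0 mulr0 add0r mul1r -rmorph_sum g_sum // rmorph0.
  under eq_bigr do rewrite fi0.
  by rewrite !sumr_cst rmorphN !rmorph_nat /=; ring.
exists F; split; last by case=> x; rewrite /= ?fi0 ?eqxx.
split.
- by rewrite !card_sum cI cJ.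
- case=> [i|j]; first by have [x fx] := f0 i; exists (inl x).
  have [jj0|jj0] := eqVneq j j0.
    exists (inl x0); rewrite /= jj0 eqxx pnatr_eq0 -lt0n.
    exact: unit_eigenbasis_gt0 ge.
  by have [y gy] := g0 j; exists (inr y); rewrite /= (negPf jj0).
- case=> [i|j] [i'|j'] neq; first 1 last.
  + exact: FL.
  + transitivity ((\sum_x F (inl i') x * (F (inr j) x)^*)^*).
      rewrite rmorph_sum; apply: eq_bigr => x _.
      by rewrite rmorphM /= conjCK mulrC.
    by rewrite FL rmorph0.
  + rewrite big_sumType /=; have jj' : j != j' by apply: contraNneq neq => ->.
    rewrite -mulr_suml sumr_const.
    have [jj0|jj0] := eqVneq j j0; have [j'j0|j'j0] := eqVneq j' j0.
    * by rewrite jj0 j'j0 eqxx in jj'.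
    * by rewrite rmorph0 mulr0 add0r -mulr_sumr -rmorph_sum g_sum // rmorph0 mulr0.
    * by rewrite mul0rn mul0r add0r -mulr_suml g_sum // mul0r.
    * by rewrite mul0rn mul0r add0r g_orth.
  + rewrite big_sumType /=; have ii' : i != i' by apply: contraNneq neq => ->.
    rewrite f_orth // add0r big1 // => y _.
    have [ii0|_] := eqVneq i i0; last by rewrite mul0r.
    by rewrite -ii0 eq_sym (negPf ii') rmorph0 mulr0.
- case=> [i|j] [x|y]; rewrite ?laplace_joinl ?laplace_joinr /=.
  + have [->|ii0] := eqVneq i i0.
      by rewrite (laplace_cst _ fi0) fi0 sumr_const add0r subrr mul0r.
    rewrite f_eig sumr_const mul0rn subr0 rmorphD rmorph_nat mulrDl.
    by rewrite mulr_natl.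
  + rewrite (@laplace_cst _ _ _ (i == i0)%:R) // addr0.
    have [->|ii0] := eqVneq i i0; last by rewrite f_sum // mul0rn subr0 mulr0.
    by under eq_bigr do rewrite fi0; rewrite sumr_const subrr mul0r.
  + rewrite (@laplace_cst _ _ _ (if j == j0 then #|H| else 0)%:R) // add0r.
    have [jj0|jj0] := eqVneq j j0; last by rewrite g_sum // mul0rn subr0 mulr0.
    by rewrite sumr_cst rmorph_nat natrD -[_%:R *+ #|H|]mulr_natr; ring.
  + have [jj0|jj0] := eqVneq j j0.
      rewrite (@laplace_cst _ _ _ (- #|G|%:R)) // addr0 sumr_cst.
      by rewrite rmorph_nat natrD -[(- _) *+ _]mulr_natr; ring.
    rewrite g_eig sumr_const mul0rn subr0 rmorphD rmorph_nat mulrDl.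
    by rewrite mulr_natl addrC.
Qed.

(** * Complete and edgeless graphs *)

Lemma complete_connected p : (0 < p)%N -> connected_graph (complete_graph p).
Proof.
move=> p_gt0; split=> [|x y]; first by rewrite card_ord.
by have [->|xy] := eqVneq x y; [exact: connect0 | exact: connect1].
Qed.

(** Non-adjacency is equality here, so the complement Laplacian is zero and [laplace_compl] forces
    the eigenvalue [p] on every zero-sum function. *)
Lemma complete_eigenbasis p : (0 < p)%N ->
  exists (I : finType) (i0 : I) (f : I -> complete_graph p -> C),
  unit_eigenbasis i0 f (fun i => if i == i0 then 0 else p%:R).
Proof.
move=> /complete_connected/connected_eigenbasis[I [i0 [f [d fd]]]].
have d0 := unit_eigenbasis_eig0 fd; have f_sum := unit_eigenbasis_sum fd.
have [[cI f0 f_orth f_eig] fi0] := fd.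
exists I, i0, f; split=> //; split=> // i x.
have [->|ii0] := eqVneq i i0; first by rewrite f_eig d0.
have := laplace_compl (@edge (complete_graph p)) (f i) x.
rewrite f_sum // subr0 (eq_bigl (pred1 x)) => [|y].
  rewrite big_pred1_eq subrr card_ord => /esym/eqP.
  by rewrite subr_eq0 => /eqP<-; rewrite rmorph_nat mulr_natl.
by rewrite /= negbK eq_sym.
Qed.

(** The Laplacian is zero, so any orthogonal family serves. The one of the complete graph on the
    same vertices is borrowed, as [connected_eigenbasis] asks for connectedness. *)
Lemma edgeless_eigenbasis p : (0 < p)%N ->
  exists (I : finType) (i0 : I) (f : I -> edgeless_graph p -> C),
  unit_eigenbasis i0 f (fun=> 0).
Proof.
move=> /complete_eigenbasis[I [i0 [f [[cI f0 f_orth f_eig] fi0]]]].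
exists I, i0, f; split=> //; split=> // i x.
by rewrite mul0r /laplace big_pred0.
Qed.

(** * The handshake identity and the trace of the Laplacian *)

Lemma sum_degree (G : sgraph) :
  (\sum_(x : G) degree x = 2 * nb_edges G)%N.
Proof.
have -> : (\sum_(x : G) degree x = \sum_(z : G * G | edge z.1 z.2) 1)%N.
  rewrite -(pair_big_dep xpredT (fun x y => edge x y) (fun _ _ => 1%N)) /=.
  by apply: eq_bigr => x _; rewrite sum1_card /degree cardsE.
rewrite (partition_big (fun z => [set z.1; z.2]) (mem (edges G))) /=; last first.
  move=> [x y] /= xy; rewrite inE; apply/existsP; exists x.
  by apply/existsP; exists y; rewrite xy eqxx.
rewrite /nb_edges mulnC -sum_nat_const; apply: eq_bigr => e.
rewrite inE => /existsP[x /existsP[y /andP[xy /eqP->]]].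
have neq : x != y by apply: contraTneq xy => ->; rewrite edge_irrefl.
(* The ordered pairs lying over an edge are exactly its two orientations. *)
transitivity #|[set (x, y); (y, x)]|; last first.
  by rewrite cards2 xpair_eqE negb_and neq.
rewrite sum1_card; apply: eq_card => -[u v].
rewrite !inE !xpair_eqE /= unfold_in /=.
apply/andP/orP => [[uv /eqP E]|[/andP[/eqP-> /eqP->]|/andP[/eqP-> /eqP->]]].
- have neq' : u != v by apply: contraTneq uv => ->; rewrite edge_irrefl.
  have: u \in [set x; y] by rewrite -E !inE eqxx.
  have: v \in [set x; y] by rewrite -E !inE eqxx orbT.
  rewrite !inE => /orP[]/eqP vE /orP[]/eqP uE; rewrite uE vE !eqxx /=;
    by [left | right | rewrite uE vE eqxx in neq'].
- by [].
- by rewrite edge_sym setUC.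
Qed.

Lemma sum_laplacian_spectrum (G : sgraph) : (0 < #|G|)%N ->
  \sum_(mu <- laplacian_spectrum R G) mu = (2 * nb_edges G)%:R.
Proof.
move=> G_gt0; have [_ spec] := sym_spectrumP (@laplacian_mx_sym R G).
have size_s : size (laplacian_spectrum R G) = #|G|.
  by apply: succn_inj; rewrite -(size_char_poly (laplacian_mx R G)) spec size_prod_XsubC.
apply: oppr_inj; rewrite -coefPn_prod_XsubC ?size_s -?lt0n // -spec.
rewrite char_poly_trace //; congr (- _).
rewrite -sum_degree natr_sum [RHS](reindex _ (onW_bij _ (enum_val_bij G))) /=.
by apply: eq_bigr => i _; rewrite !mxE eqxx edge_irrefl subr0.
Qed.

Lemma eigenbasis_sum (G : sgraph) (I : finType) (f : I -> G -> C) (d : I -> R) :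
  (0 < #|G|)%N -> eigenbasis f d -> \sum_i d i = (2 * nb_edges G)%:R.
Proof.
move=> G_gt0 /eigenbasis_spectrum s_d.
by rewrite -sum_laplacian_spectrum // (perm_big _ s_d) big_map big_enum.
Qed.

(** Carries a bound on one entry of the sorted spectrum over to the indexed family [d]: if
    [d i <= t] as well as [d i0 <= t], the spectrum has two entries at most [t], whereas only its
    last entry can be. *)
Lemma spectral_gap (G : sgraph) (I : finType) (i0 : I) (f : I -> G -> C)
    (d : I -> R) (t : R) :
  eigenbasis f d -> d i0 <= t -> t < laplacian_eig R G #|G|.-1 ->
  forall i, i != i0 -> t < d i.
Proof.
move=> fd d0t gap i ii0; rewrite ltNge; apply/negP => dit.
have s_d := eigenbasis_spectrum fd.
have [s_sorted _] := sym_spectrumP (@laplacian_mx_sym R G).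
rewrite -/(laplacian_spectrum R G) in s_sorted.
set s := laplacian_spectrum R G in s_d s_sorted.
have size_s : size s = #|G|.
  by rewrite (perm_size s_d) size_map -cardE; have [] := fd.
pose P x := x <= t; have : (1 < count P s)%N.
  rewrite (permP s_d) count_map -size_filter.
  have -> : 2%N = #|[set i0; i]| by rewrite cards2 eq_sym ii0.
  rewrite cardE; apply: uniq_leq_size => [|j]; first exact: enum_uniq.
  by rewrite mem_enum mem_filter mem_enum !inE /P => /orP[]/eqP->; rewrite andbT.
have G_gt1 : (1 < #|G|)%N.
  rewrite -size_s (perm_size s_d) size_map -cardE.
  have -> : 2%N = #|[set i0; i]| by rewrite cards2 eq_sym ii0.
  exact: max_card.
apply/negP; rewrite -leqNgt -(cat_take_drop #|G|.-1 s) count_cat.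
(* [laplacian_eig] counts from 1, so the eigenvalue in [gap] sits at index [#|G|.-2]: it is the
   last, hence smallest, of the first [#|G|.-1] entries. *)
have /eqP -> : count P (take #|G|.-1 s) == 0%N.
  rewrite -leqn0 leqNgt -has_count -all_predC; apply/(all_nthP 0) => k.
  rewrite size_takel ?size_s ?leq_pred // => k_lt.
  rewrite nth_take //= /P -ltNge; apply: lt_le_trans gap _.
  rewrite /laplacian_eig -/s.
  have := @sorted_leq_nth _ >=%R (@ge_trans _ R) (@ge_refl _ R) 0 s s_sorted.
  apply; rewrite ?inE ?size_s; lia.
rewrite add0n; apply: leq_trans (count_size _ _) _.
by rewrite size_drop size_s; lia.
Qed.

(** * The energy of the product graph *)

Lemma sum_if_eq (I : finType) (i0 : I) (a : R) (b : I -> R) :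
  \sum_i (if i == i0 then a else b i) = a + \sum_(i | i != i0) b i.
Proof.
rewrite (bigD1 i0) //= eqxx; congr (_ + _).
by apply: eq_bigr => i /negPf->.
Qed.

Lemma sum_const_neq (I : finType) (i0 : I) (a : R) :
  \sum_(i | i != i0) a = (#|I|%:R - 1) * a.
Proof.
rewrite sumr_const cardC1 -subn1 mulrnBr; last by apply/card_gt0P; exists i0.
by rewrite mulrBl mul1r mulr_natl.
Qed.

(** [h a] is the share of the energy coming from an eigenvalue [a] of the join. The value on the
    right involves [G] only through its numbers of vertices and edges; the terms [h 0], [h (n + q)]
    and [h n] can therefore keep their absolute values. *)
Lemma energy_join_cart (G : sgraph) (p : nat) :
  connected_graph G -> (2 <= #|G|)%N -> (#|G| + 4 <= p)%N ->
  (2 * nb_edges G)%:R / (p + #|G|)%:R < laplacian_eig R G #|G|.-1 ->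
  let n : R := #|G|%:R in let q : R := p%:R in
  let m2 : R := (2 * nb_edges G)%:R in
  let c := (m2 + 2 * n * q) / (n + q) + q - 1 in
  let h a := `|a - c| + (q - 1) * `|a + q - c| in
  laplacian_energy R
    (cart_graph (join_graph G (edgeless_graph p)) (complete_graph p)) =
  h 0 + ((q - 2) * m2 + (n - 1) * (c - q + (q - 1) * (2 * q - c)))
  + (h (n + q) + (q - 1) * h n).
Proof.
move=> G_conn n_ge2 p_ge gap n q m2 c h.
have p_gt0 : (0 < p)%N by lia.
have [I [i0 [f [d fd]]]] := connected_eigenbasis G_conn.
have [J [j0 [g ge]]] := edgeless_eigenbasis p_gt0.
have [K [k0 [u uK]]] := complete_eigenbasis p_gt0.
have [F FA] := join_eigenbasis fd ge.
set A := fun k => _ in FA; set B := fun k => _ in uK.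
have [[cI _ _ _] _] := fd; have [[cJ _ _ _] _] := ge; have [[cK _ _ _] _] := uK.
rewrite card_ord in cJ; rewrite card_ord in cK.
have big_eig := cart_eigenbasis (proj1 FA) (proj1 uK).
set BG := cart_graph _ _ in big_eig *.
have cBG : #|BG| = ((#|G| + p) * p)%N by rewrite card_prod card_sum !card_ord.
have BG_gt0 : (0 < #|BG|)%N by rewrite cBG; nia.
have nR : 2 <= n by rewrite /n ler_nat.
have qR : n + 4 <= q by rewrite /n /q -natrD ler_nat.
have sum_d : \sum_(i | i != i0) d i = m2.
  rewrite /m2 -(eigenbasis_sum (unit_eigenbasis_gt0 fd) (proj1 fd)).
  by rewrite [RHS](bigD1 i0) //= (unit_eigenbasis_eig0 fd) add0r.
have sumJ (a b : R) : \sum_(j : J) (if j == j0 then a else b) = a + (q - 1) * b.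
  by rewrite sum_if_eq sum_const_neq cJ.
have sumK (a b : R) : \sum_(k : K) (if k == k0 then a else b) = a + (q - 1) * b.
  by rewrite sum_if_eq sum_const_neq cK.
(* Stated for arbitrary [w], because it serves both for the average degree and for the energy. *)
have AE (w : R -> R) : \sum_k w (A k) =
    w 0 + \sum_(i | i != i0) w (d i + q) + (w (n + q) + (q - 1) * w n).
  rewrite big_sumType /= card_ord; congr (_ + _).
    by rewrite -sum_if_eq; apply: eq_bigr => i _; case: eqP.
  by rewrite -sumJ; apply: eq_bigr => j _; rewrite natrD add0r; case: eqP.
have BE (w : R -> R) : \sum_k w (B k) = w 0 + (q - 1) * w q.
  by rewrite -sumK; apply: eq_bigr => k _; rewrite /B; case: eqP.
(* The edges of the product are not counted directly: twice their number is the sum of the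
   eigenvalues. *)
have avg : (2 * nb_edges BG)%:R / #|BG|%:R = c.
  rewrite -(eigenbasis_sum BG_gt0 big_eig) /=.
  rewrite -(pair_bigA _ (fun k l => A k + B l)) /=.
  under eq_bigr => k _ do rewrite (BE (fun b => A k + b)).
  rewrite (AE (fun a => a + 0 + (q - 1) * (a + q))).
  have -> : \sum_(i | i != i0) (d i + q + 0 + (q - 1) * (d i + q + q)) =
      \sum_(i | i != i0) (q * d i + (q + (q - 1) * (q + q))).
    by apply: eq_bigr => i _; ring.
  rewrite big_split /= -mulr_sumr sum_d sum_const_neq cI -/n.
  rewrite cBG natrM natrD -/n -/q /c; field; lra.
rewrite /laplacian_energy avg (perm_big _ (eigenbasis_spectrum big_eig)) /=.
rewrite big_map big_enum /= -(pair_bigA _ (fun k l => `|A k + B l - c|)) /=.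
under eq_bigr => k _ do rewrite (BE (fun b => `|A k + b - c|)) addr0.
rewrite (AE h); congr (_ + _ + _).
(* [t] is the threshold of the gap hypothesis and [v] the harmonic mean of [n] and [q], with
   [c = t + v + q - 1]. Then [n + 1 <= v] yields [d i + q <= c], and [v <= q + 1] yields
   [d i + 2 * q >= c]. The lower bound on [v] uses [n >= 2] and [q >= n + 4], and is an equality at
   [n = 2], [q = 6]. *)
pose t := m2 / (n + q); pose v := 2 * n * q / (n + q).
have nq_gt0 : 0 < n + q by lra.
have cE : c = t + v + q - 1 by rewrite /c mulrDl.
have t_ge0 : 0 <= t by rewrite divr_ge0 ?ler0n // ltW.
have v_ge : n + 1 <= v by rewrite ler_pdivlMr //; nra.
have v_le : v <= q + 1 by rewrite ler_pdivrMr //; nra.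
have d_gap i : i != i0 -> t < d i.
  apply: spectral_gap (proj1 fd) _ _ i; first by rewrite (unit_eigenbasis_eig0 fd).
  by rewrite /t /n /q -natrD addnC.
transitivity (\sum_(i | i != i0)
    ((q - 2) * d i + (c - q + (q - 1) * (2 * q - c)))).
  apply: eq_bigr => i ii0; rewrite /h.
  have d_le : d i <= n := unit_eigenbasis_eig_le fd i.
  have d_gt := d_gap i ii0.
  rewrite ler0_norm; last by lra.
  by rewrite ger0_norm; [ring | lra].
by rewrite big_split /= -mulr_sumr sum_d sum_const_neq cI.
Qed.

End Eigenbasis.

Theorem theorem4p8 (R : rcfType) (G1 G2 : sgraph) (n m p : nat)
    (hn : (2 <= n)%N)
    (hV1 : #|G1| = n) (hV2 : #|G2| = n)
    (hE1 : nb_edges G1 = m) (hE2 : nb_edges G2 = m)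
    (hG1 : connected_graph G1) (hG2 : connected_graph G2)
    (hp : (n + 4 <= p)%N)
    (hmu : (2 * m)%:R / (p + n)%:R <
           Num.min (laplacian_eig R G1 n.-1) (laplacian_eig R G2 n.-1)) :
  laplacian_energy R
    (cart_graph (join_graph G1 (edgeless_graph p)) (complete_graph p)) =
  laplacian_energy R
    (cart_graph (join_graph G2 (edgeless_graph p)) (complete_graph p)).
Proof.
move: hmu; rewrite lt_min => /andP[gap1 gap2].
by rewrite !energy_join_cart ?hV1 ?hV2 ?hE1 ?hE2.
Qed.
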